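(* Let $M$ be a Riemannian manifold, $\Omega\subset M$ a domain, $\epsilon>0$, $p>1$, and let $u_\epsilon$ be a solution on $\Omega$ of the perturbed $p$-Laplace equation $$\mathrm{div}\left(\left(|\nabla u_\epsilon|^2+\epsilon\right)^{\frac{p-2}{2}}\nabla u_\epsilon\right)=0.$$ Let $f_\epsilon=\sqrt{|\nabla u_\epsilon|^2+\epsilon}$ and let $\nabla du_\epsilon$ be the Hessian of $u_\epsilon$. Then $$\frac12\mathcal{L}_\epsilon(f_\epsilon^2)=\frac{p-2}{4}f_\epsilon^{p-4}\left|\nabla f_\epsilon^2\right|^2+f_\epsilon^{p-2}\left(|\nabla du_\epsilon|^2+\mathrm{Ric}(\nabla u_\epsilon,\nabla u_\epsilon)\right).$$
   Context: Solutions $u_\epsilon$ are $C^\infty$ on $\Omega$ (the equation is nondegenerate). The linearized operator is defined for $\Psi\in C^2(\Omega)$ by $$\mathcal{L}_\epsilon(\Psi)=\mathrm{div}\left(f_\epsilon^{p-2}A_\epsilon(\nabla\Psi)\right),\qquad A_\epsilon=\mathrm{id}+(p-2)\frac{\nabla u_\epsilon\otimes\nabla u_\epsilon}{f_\epsilon^2},$$ i.e. $A_\epsilon(X)=X+(p-2)f_\epsilon^{-2}\langle\nabla u_\epsilon,X\rangle\nabla u_\epsilon$. $\mathrm{Ric}$ is the Ricci tensor of $M$. *)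

(* Defs.v *)
From mathcomp Require Import all_boot all_order all_algebra.
From mathcomp Require Import all_classical all_reals all_analysis.
Import Order.TTheory GRing.Theory Num.Theory numFieldNormedType.Exports.

Set Implicit Arguments.
Unset Strict Implicit.
Unset Printing Implicit Defensive.

Local Open Scope classical_set_scope.
Local Open Scope ring_scope.

Section EuclideanSpace.
Variables (R : realType) (n : nat).

Definition partial (i : 'I_n) (F : 'rV[R]_n -> R) (y : 'rV[R]_n) : R :=
  'D_(delta_mx 0 i) F y.

Definition partials (s : seq 'I_n) (F : 'rV[R]_n -> R) : 'rV[R]_n -> R :=
  foldr partial F s.

(* C^oo on U, where U is meant to be open *)
Definition smooth_on (U : set 'rV[R]_n) (F : 'rV[R]_n -> R) : Prop :=
  forall (s : seq 'I_n) (y : 'rV[R]_n), U y -> differentiable (partials s F) y.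

End EuclideanSpace.

(* A smooth manifold of dimension n: a Hausdorff second countable space with a
   smooth atlas, not required to be maximal.  chart_inv c is the inverse of
   chart_map c on the image of chart_dom c, and is arbitrary elsewhere.  As part
   of the data, chart_at x is a preferred chart around x, in which the values at
   x of the tensorial operations below are computed; these values are
   independent of that choice. *)
Record manifold (R : realType) (n : nat) := Manifold {
  carrier :> topologicalType;
  chart : Type;
  chart_dom : chart -> set carrier;
  chart_map : chart -> carrier -> 'rV[R]_n;
  chart_inv : chart -> 'rV[R]_n -> carrier;
  chart_at : carrier -> chart;
  manifold_hausdorff : hausdorff_space carrier;
  manifold_second_countable : @second_countable carrier;
  chart_at_dom : forall x, chart_dom (chart_at x) x;
  chart_dom_open : forall c, open (chart_dom c);
  chart_img_open : forall c, open (chart_map c @` chart_dom c);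
  chart_mapK : forall c x, chart_dom c x -> chart_inv c (chart_map c x) = x;
  chart_map_continuous : forall c, {within chart_dom c, continuous (chart_map c)};
  chart_inv_continuous : forall c,
    {within chart_map c @` chart_dom c, continuous (chart_inv c)};
  chart_transition_smooth : forall c d (k : 'I_n),
    smooth_on (chart_map c @` (chart_dom c `&` chart_dom d))
              (fun y => chart_map d (chart_inv c y) 0 k)
}.

Section Manifold.
Variables (R : realType) (n : nat) (M : manifold R n).

(* The coordinate derivative of F along the i-th coordinate of the chart c,
   significant on chart_dom c only. *)
Definition pd (c : chart M) (i : 'I_n) (F : M -> R) (x : M) : R :=
  partial i (F \o chart_inv c) (chart_map c x).

Definition msmooth_on (A : set M) (F : M -> R) : Prop :=
  forall c : chart M,
    smooth_on (chart_map c @` (chart_dom c `&` A)) (F \o chart_inv c).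

Definition domain (A : set M) : Prop := [/\ open A, A !=set0 & connected A].

(* A vector field (resp. covariant 2-tensor field) T is given by its components
   in every chart: T c x are the components at x in the chart c, significant
   when x is in chart_dom c. *)
Definition vfield := chart M -> M -> 'rV[R]_n.
Definition tensor2 := chart M -> M -> 'M[R]_n.

Definition eval2 (T : tensor2) (X Y : vfield) (x : M) : R :=
  let c := chart_at x in
  \sum_(i < n) \sum_(j < n) T c x i j * X c x 0 i * Y c x 0 j.

End Manifold.

Record riemannian (R : realType) (n : nat) := Riemannian {
  rmanifold :> manifold R n;
  metric : tensor2 rmanifold;
  metric_sym : forall c x, chart_dom c x -> (metric c x)^T = metric c x;
  metric_pos : forall c x, chart_dom c x ->
    forall v : 'rV[R]_n, v != 0 -> 0 < (v *m metric c x *m v^T) 0 0;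
  metric_smooth : forall c i j,
    smooth_on (chart_map c @` chart_dom c)
              (fun y => metric c (chart_inv c y) i j);
  metric_change : forall c d x, chart_dom c x -> chart_dom d x ->
    forall i j, metric c x i j =
      \sum_(a < n) \sum_(b < n)
         pd c i (fun y => chart_map d y 0 a) x
       * pd c j (fun y => chart_map d y 0 b) x * metric d x a b
}.

Section Riemannian.
Variables (R : realType) (n : nat) (M : riemannian R n).

(* the components g^{ij} *)
Definition cometric (c : chart M) (x : M) : 'M[R]_n := invmx (metric c x).

Definition inner (X Y : vfield M) : M -> R := eval2 (@metric _ _ M) X Y.

Definition normsq (X : vfield M) : M -> R := inner X X.

Definition grad (u : M -> R) : vfield M := fun c x =>
  \row_k \sum_(l < n) cometric c x k l * pd c l u x.

(* the Christoffel symbol Gamma^k_{ij} of the Levi-Civita connection *)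
Definition christoffel (c : chart M) (k i j : 'I_n) (x : M) : R :=
  2^-1 * \sum_(l < n) cometric c x k l *
    (pd c i (fun y => metric c y j l) x + pd c j (fun y => metric c y i l) x
     - pd c l (fun y => metric c y i j) x).

(* the trace of the covariant derivative of X *)
Definition div (X : vfield M) (x : M) : R :=
  let c := chart_at x in
  \sum_(i < n) (pd c i (fun y => X c y 0 i) x
                + \sum_(j < n) christoffel c i i j x * X c x 0 j).

(* the Hessian (nabla du)_{ij} *)
Definition hess (u : M -> R) : tensor2 M := fun c x =>
  \matrix_(i, j) (pd c i (pd c j u) x
                  - \sum_(k < n) christoffel c k i j x * pd c k u x).

Definition tensor2_normsq (T : tensor2 M) (x : M) : R :=
  let c := chart_at x in
  \sum_(i < n) \sum_(j < n) \sum_(k < n) \sum_(l < n)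
    cometric c x i k * cometric c x j l * T c x i j * T c x k l.

(* the component along d_l of R(d_i, d_j) d_k, with
   R(X, Y) Z = nabla_X nabla_Y Z - nabla_Y nabla_X Z - nabla_[X, Y] Z *)
Definition curvature (c : chart M) (l k i j : 'I_n) (x : M) : R :=
  pd c i (christoffel c l j k) x - pd c j (christoffel c l i k) x
  + \sum_(m < n) (christoffel c l i m x * christoffel c m j k x
                  - christoffel c l j m x * christoffel c m i k x).

(* Ric(Y, Z) is the trace of X |-> R(X, Y) Z *)
Definition ricci : tensor2 M := fun c x =>
  \matrix_(j, k) \sum_(i < n) curvature c i k i j x.

Definition vscale (h : M -> R) (X : vfield M) : vfield M := fun c x =>
  h x *: X c x.

Definition vadd (X Y : vfield M) : vfield M := fun c x => X c x + Y c x.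

Section PLaplace.
Variables (eps p : R) (u : M -> R).

(* A solution is a classical one: the equation is nondegenerate, so that its
   solutions are smooth. *)
Definition perturbed_pharmonic_on (A : set M) : Prop :=
  msmooth_on A u /\
  forall x, A x ->
    div (vscale (fun y => (normsq (grad u) y + eps) `^ ((p - 2) / 2)) (grad u)) x
    = 0.

Definition feps (x : M) : R := Num.sqrt (normsq (grad u) x + eps).

Definition Aeps (X : vfield M) : vfield M :=
  vadd X (vscale (fun x => (p - 2) / feps x ^+ 2 * inner (grad u) X x) (grad u)).

Definition Leps (Psi : M -> R) : M -> R :=
  div (vscale (fun x => feps x `^ (p - 2)) (Aeps (grad Psi))).

End PLaplace.
End Riemannian.

(* Main.v *)
(* With X = grad u, w = |X|^2 and q = (w + eps)^((p - 2) / 2), the equation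
   div (q X) = 0 reads (p - 2) (w + eps)^-1 <X, grad w> = - 2 Delta u, so that the
   field whose divergence is L(f^2) is q grad w - 2 (Delta u) q X.  As q X is
   divergence free, L(f^2) = q Delta w + <grad q, grad w> - 2 q <X, grad Delta u>,
   and Bochner's formula for Delta w concludes.

   Since the equation is differentiated, it is needed in one fixed chart around
   the point, whereas it is given at each y in the chart [chart_at y]: one has to
   know that <grad F, grad G> and Delta F do not depend on the chart.  For the
   former this is the chain rule; the Hessian of F is then obtained from it by
     2 Hess F (grad a, grad b)
       = <grad a, grad <F, b>> + <grad b, grad <F, a>> - <grad F, grad <a, b>>,
   where <F, b> = <grad F, grad b>, so that second derivatives of the change of
   charts never occur. *)

Require Import Defs.
From mathcomp Require Import all_boot all_order all_algebra.
From mathcomp Require Import all_classical all_reals all_analysis.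
From mathcomp Require Import ring lra.
Import Order.TTheory GRing.Theory Num.Theory numFieldNormedType.Exports.
Set Implicit Arguments.
Unset Strict Implicit.
Unset Printing Implicit Defensive.

Local Open Scope classical_set_scope.
Local Open Scope ring_scope.

(** * Smooth functions on open subsets of R^n *)

(** The first-order expansion of [f] at [x] is also one of [g], so uniqueness of the differential
    gives ['d g x = 'd f x]. *)
Lemma near_differentiable (R : realType) (V W : normedModType R) (f g : V -> W) (x : V) :
  (\near x, f x = g x) -> differentiable f x -> differentiable g x.
Proof.
move=> fg df; have fgx : f x = g x by exact: nbhs_singleton fg.
have [cf ef] := (diff_locallyP x f).1 df.
have eg : g \o shift x = cst (g x) + 'd f x +o_ 0 id.
  rewrite -fgx; apply/eqaddoP => _/posnumP[e].
  move/eqaddoP: ef => /(_ e%:num ltac:(by [])) ef.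
  have fg0 : \forall h \near (0:V), f (h + x) = g (h + x).
    by move: fg; rewrite (near_shift 0)/=; apply: filterS => h /=; rewrite subr0.
  by apply: filterS2 fg0 ef => h /= fgh; rewrite !fctE /= fgh.
apply/diff_locallyP.
have dg : 'd g x = 'd f x :> (V -> W) by apply: diff_unique.
by rewrite dg.
Qed.

Section Euclid.
Context {R : realType} {n : nat}.
Implicit Types (F G : 'rV[R]_n -> R) (U : set 'rV[R]_n) (y v w : 'rV[R]_n).

(** * Mean value theorem along lines and symmetry of second derivatives *)

Lemma is_derive_line F y v t : differentiable F (t *: v + y) ->
  is_derive (t : R) 1 (fun t : R => F (t *: v + y)) ('D_v F (t *: v + y)).
Proof.
move=> dF.
have dl : is_diff t (fun t : R => t *: v + y) ( *:%R ^~ v).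
  by apply: is_diff_eq; rewrite funeqE => s; rewrite !fctE addr0.
have dc : differentiable (F \o (fun t : R => t *: v + y)) t.
  by apply: differentiable_comp => //; apply: ex_diff.
apply: DeriveDef; first exact/derivable1_diffP.
by rewrite deriveE // diff_comp //= diff_val scale1r deriveE.
Qed.

Lemma MVT_line F y v h : 0 < h ->
  (forall t, 0 <= t <= h -> differentiable F (t *: v + y)) ->
  exists2 t, 0 < t < h & F (h *: v + y) - F y = 'D_v F (t *: v + y) * h.
Proof.
move=> h0 dF.
have [||t] := @MVT R (fun t : R => F (t *: v + y)) (fun t => 'D_v F (t *: v + y)) 0 h h0.
- move=> t; rewrite in_itv /= => /andP[t0 th]; apply: is_derive_line.
  by apply: dF; rewrite !ltW.
- apply: derivable_within_continuous => t; rewrite in_itv /= => th.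
  by have [] := is_derive_line (dF t th).
by rewrite in_itv /= scale0r add0r subr0 => ht e; exists t.
Qed.

Lemma differentiable_translate F a y :
  differentiable F (a + y) -> differentiable (fun z => F (a + z)) y.
Proof.
by move=> dF; apply: (@differentiable_comp _ _ _ _ (fun z => a + z) F).
Qed.

Lemma derive_translate F v a y : differentiable F (a + y) ->
  'D_v (fun z => F (a + z)) y = 'D_v F (a + y).
Proof.
move=> dF; rewrite deriveE; last exact: differentiable_translate.
rewrite (deriveE v dF).
have dt : is_diff y (fun z => a + z) id.
  by have := is_diffD (is_diff_cst a y) (is_diff_id y); rewrite add0r.
have dF' : is_diff ((fun z => a + z) y) F ('d F (a + y)) by exact: differentiableP.
have /(congr1 (fun g => g v)) := @diff_val _ _ _ _ _ _ _ (is_diff_comp dt dF').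
exact.
Qed.

(** Divided by [h ^+ 2], a discrete mixed derivative. Its evident symmetry in [v] and [w] is what
    forces that of the true one. *)
Definition second_difference F y v w (h : R) : R :=
  F (h *: v + (h *: w + y)) - F (h *: v + y) - (F (h *: w + y) - F y).

Lemma second_differenceC F y v w h :
  second_difference F y v w h = second_difference F y w v h.
Proof. rewrite /second_difference addrCA; ring. Qed.

(** The mean value theorem is used twice: along [v] for the increment [G] of [F] by [h *: w], then
    along [w] for ['D_v F]. *)
Lemma second_differenceE F y v w h : 0 < h ->
  (forall s t, 0 <= s <= h -> 0 <= t <= h ->
     differentiable F (s *: v + (t *: w + y)) /\
     differentiable ('D_v F) (s *: v + (t *: w + y))) ->
  exists s t, [/\ 0 < s < h, 0 < t < h &
    second_difference F y v w h = 'D_w ('D_v F) (s *: v + (t *: w + y)) * h ^+ 2].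
Proof.
move=> h0 dF.
have hh : 0 <= h <= h by rewrite !lexx ltW.
have h00 : (0 : R) <= 0 <= h by rewrite lexx ltW.
pose G z := F (h *: w + z) - F z.
have dFh s : 0 <= s <= h -> differentiable (fun z => F (h *: w + z)) (s *: v + y).
  by move=> hs; apply: differentiable_translate; rewrite addrCA; exact: (dF s h hs hh).1.
have dF0 s : 0 <= s <= h -> differentiable F (s *: v + y).
  by move=> hs; have := (dF s 0 hs h00).1; rewrite scale0r add0r.
have dG s : 0 <= s <= h -> differentiable G (s *: v + y).
  by move=> hs; apply: differentiableB; [exact: dFh|exact: dF0].
have [s hs es] := MVT_line h0 dG.
have hs' : 0 <= s <= h by case/andP: hs => /ltW -> /ltW ->.
have eG : 'D_v G (s *: v + y) =
    'D_v F (h *: w + (s *: v + y)) - 'D_v F (s *: v + y).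
  rewrite -(@derive_translate F v (h *: w)); last by rewrite addrCA; exact: (dF s h hs' hh).1.
  have -> : G = (fun z => F (h *: w + z)) - F by [].
  rewrite deriveB //; first by apply: diff_derivable; exact: dFh.
  by apply: diff_derivable; exact: dF0.
have [|t ht et] := @MVT_line ('D_v F) (s *: v + y) w h h0.
  by move=> t ht; rewrite addrCA; exact: (dF s t hs' ht).2.
exists s, t; split => //.
rewrite addrCA expr2 mulrA -et -eG -es /second_difference /G.
by rewrite [h *: w + (h *: v + y)]addrCA; ring.
Qed.

(* Both second differences along v then w, and w then v, agree; the mean value
   theorem turns each into a mixed derivative at a nearby point. *)
Lemma derive_comm F y v w :
  (\forall z \near y, differentiable F z) ->
  (\forall z \near y, differentiable ('D_v F) z) ->
  (\forall z \near y, differentiable ('D_w F) z) ->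
  {for y, continuous ('D_w ('D_v F))} ->
  {for y, continuous ('D_v ('D_w F))} ->
  'D_w ('D_v F) y = 'D_v ('D_w F) y.
Proof.
move=> dF dvF dwF cwv cvw.
apply/eqP; rewrite -subr_eq0 -normr_eq0; apply/eqP/le_anti.
rewrite normr_ge0 andbT; apply/ler_addgt0Pr => e e0; rewrite add0r.
have e2 : 0 < e / 2 by lra.
have H : \forall z \near y, [/\ differentiable F z, differentiable ('D_v F) z,
    differentiable ('D_w F) z, `|'D_w ('D_v F) y - 'D_w ('D_v F) z| < e / 2
    & `|'D_v ('D_w F) y - 'D_v ('D_w F) z| < e / 2].
  move/cvgrPdist_lt/(_ _ e2): cwv => cwv.
  move/cvgrPdist_lt/(_ _ e2): cvw => cvw.
  pose I := @filterI _ _ (nbhs_filter y).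
  have := I _ _ dF (I _ _ dvF (I _ _ dwF (I _ _ cwv cvw))).
  apply: filterS => z [h1 [h2 [h3 [h4 h5]]]].
  exact (And5 h1 h2 h3 h4 h5).
have /nbhs_ballP[r /= r0 Hr] := H.
(* With this [h], every point [s *: v + (t *: w + y)] with [s, t <= h] is within [r / 2] of [y]; the
   summand 1 keeps the denominator positive. *)
pose h := r / (`|v| + `|w| + 1) / 2.
have nv := normr_ge0 v; have nw := normr_ge0 w.
have N0 : 0 < `|v| + `|w| + 1 by lra.
have h0 : 0 < h by rewrite /h !divr_gt0.
have Hh s t : 0 <= s <= h -> 0 <= t <= h -> ball y r (s *: v + (t *: w + y)).
  move=> /andP[s0 sh] /andP[t0 th]; rewrite -ball_normE /= addrA distrC addrK.
  apply: le_lt_trans (ler_normD _ _) _; rewrite !normrZ !ger0_norm //.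
  have : s * `|v| + t * `|w| <= h * (`|v| + `|w| + 1).
    by have := ler_wpM2r nv sh; have := ler_wpM2r nw th; lra.
  move=> /le_lt_trans; apply; rewrite /h mulrAC divfK ?gt_eqF //; lra.
have [|s [t [hs ht e1]]] := @second_differenceE F y v w h h0.
  by move=> s t hs ht; have [] := Hr _ (Hh s t hs ht).
have [|s' [t' [hs' ht' e1']]] := @second_differenceE F y w v h h0.
  by move=> s' t' hs' ht'; have [] := Hr _ (Hh t' s' ht' hs'); rewrite addrCA.
have W r' : 0 < r' < h -> 0 <= r' <= h by case/andP => /ltW-> /ltW->.
have [_ _ _ b1 _] := Hr _ (Hh s t (W _ hs) (W _ ht)).
have [_ _ _ _ b2] := Hr _ (Hh t' s' (W _ ht') (W _ hs')).
(* Dividing the common second difference by [h ^+ 2] equates the two mixed derivatives at two nearby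
   points, each within [e / 2] of its value at [y]. *)
have : 'D_w ('D_v F) (s *: v + (t *: w + y)) = 'D_v ('D_w F) (t' *: v + (s' *: w + y)).
  have hn : h ^+ 2 != 0 by rewrite expf_neq0 // gt_eqF.
  have := etrans (esym e1) (etrans (second_differenceC _ _ _ _ _) e1').
  by move/(mulIf hn) => ->; rewrite addrCA.
move=> E; rewrite E in b1.
apply: le_trans (ler_distD ('D_v ('D_w F) (t' *: v + (s' *: w + y))) _ _) _.
rewrite [X in _ + X]distrC (splitr e).
exact (lerD (ltW b1) (ltW b2)).
Qed.

Lemma open_near (T : topologicalType) (U : set T) (P : T -> Prop) (y : T) :
  open U -> U y -> (forall z, U z -> P z) -> \near y, P y.
Proof. by move=> oU Uy UP; apply: filterS UP _; exact: open_nbhs_nbhs. Qed.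

Lemma derive_comp F (g : R -> R) dg y v :
  differentiable F y -> is_derive (F y) 1 g dg ->
  differentiable (fun z => g (F z)) y /\
  'D_v (fun z => g (F z)) y = dg * 'D_v F y.
Proof.
move=> dF [] /derivable1_diffP dg1 Dg.
have d := differentiable_comp dF dg1; split; first exact d.
rewrite (deriveE v dF).
have := deriveE v d; rewrite /comp => ->.
have /(congr1 (fun h => h v)) /= := diff_comp dF dg1.
rewrite /comp => ->.
by rewrite diff1E //= derive1E Dg mulrC.
Qed.

Lemma partialD i F G y : differentiable F y -> differentiable G y ->
  partial i (fun z => F z + G z) y = partial i F y + partial i G y.
Proof.
by move=> dF dG; exact (deriveD (diff_derivable dF) (diff_derivable dG)).
Qed.

Lemma partialM i F G y : differentiable F y -> differentiable G y ->
  partial i (fun z => F z * G z) y = partial i F y * G y + F y * partial i G y.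
Proof.
move=> dF dG; apply: etrans (deriveM (@diff_derivable _ _ _ _ _ (delta_mx 0 i) dF)
  (@diff_derivable _ _ _ _ _ (delta_mx 0 i) dG)) _.
rewrite addrC; congr (_ + _); exact: mulrC.
Qed.

Lemma eq_on_partial i F G U y : open U -> U y ->
  (forall z, U z -> F z = G z) -> partial i F y = partial i G y.
Proof.
by move=> oU Uy FG; apply: near_eq_derive; exact: (open_near oU Uy FG).
Qed.

Lemma eq_on_partials s F G U : open U ->
  (forall z, U z -> F z = G z) -> forall z, U z -> partials s F z = partials s G z.
Proof.
move=> oU FG; elim: s => [|i s IH] //= z Uz.
exact: eq_on_partial oU Uz IH.
Qed.

(** * Stability properties of smooth functions *)

Lemma smooth_on_sub U U' F : U' `<=` U -> smooth_on U F -> smooth_on U' F.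
Proof. by move=> UU sF s y /UU; exact: sF. Qed.

Lemma smooth_on_diff U F y : smooth_on U F -> U y -> differentiable F y.
Proof. by move=> sF; exact (sF [::] y). Qed.

(** The last index of the list is the innermost derivative, hence [rcons]. *)
Lemma smooth_on_partial U F i : smooth_on U F -> smooth_on U (partial i F).
Proof.
by move=> sF s; have := sF (rcons s i); rewrite /partials foldr_rcons.
Qed.

(** A coinduction principle: derivatives are replaced one at a time by members of [P]. As [U] is
    open, agreement on [U] suffices, so that formulas valid only there, as for powers and inverses,
    may be used. *)
Lemma smooth_on_coind U (P : ('rV[R]_n -> R) -> Prop) : open U ->
  (forall F, P F -> (forall y, U y -> differentiable F y) /\
     forall i, exists2 G, P G & forall y, U y -> partial i F y = G y) ->
  forall F, P F -> smooth_on U F.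
Proof.
move=> oU PP F PF s; elim/last_ind: s F PF => [|s i IH] F PF y Uy.
  exact: (PP F PF).1.
rewrite /partials foldr_rcons -/(partials s (partial i F)).
have [G PG FG] := (PP F PF).2 i.
have E := eq_on_partials s oU FG.
by apply: near_differentiable (IH G PG y Uy); apply: (open_near oU Uy) => z /E.
Qed.

(* Stability of [smooth_on] under all operations is proved at once, as the closure
   satisfies the coinduction principle above. *)
Inductive smooth_closure U : ('rV[R]_n -> R) -> Prop :=
| SCsmooth F : smooth_on U F -> smooth_closure U F
| SCcst a : smooth_closure U (fun=> a)
| SCadd F G : smooth_closure U F -> smooth_closure U G ->
    smooth_closure U (fun z => F z + G z)
| SCmul F G : smooth_closure U F -> smooth_closure U G ->
    smooth_closure U (fun z => F z * G z)
| SCpow F a : (forall z, U z -> 0 < F z) -> smooth_closure U F ->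
    smooth_closure U (fun z => F z `^ a)
| SCinv F : (forall z, U z -> F z != 0) -> smooth_closure U F ->
    smooth_closure U (fun z => (F z)^-1).

Lemma partial_cst i (a : R) y : partial i (fun=> a) y = 0.
Proof. exact: derive_cst. Qed.

Lemma smooth_closureP U F : open U -> smooth_closure U F -> smooth_on U F.
Proof.
move=> oU; apply: (smooth_on_coind oU) => {F} F; elim=> {F}.
- move=> F sF; split=> [y|i]; first exact: smooth_on_diff.
  by exists (partial i F) => //; apply: SCsmooth; exact: smooth_on_partial.
- move=> a; split=> [y _|i]; first exact: differentiable_cst.
  by exists (fun=> 0) => [|y _]; [exact: SCcst|exact: partial_cst].
- move=> F G cF [dF IF] cG [dG IG]; split=> [y Uy|i].
    exact (differentiableD (dF y Uy) (dG y Uy)).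
  have [F' cF' FF'] := IF i; have [G' cG' GG'] := IG i.
  exists (fun z => F' z + G' z); first exact: SCadd.
  by move=> y Uy; rewrite (partialD i (dF y Uy) (dG y Uy)) FF' // GG'.
- move=> F G cF [dF IF] cG [dG IG]; split=> [y Uy|i].
    exact (differentiableM (dF y Uy) (dG y Uy)).
  have [F' cF' FF'] := IF i; have [G' cG' GG'] := IG i.
  exists (fun z => F' z * G z + F z * G' z).
    by apply: SCadd; apply: SCmul.
  by move=> y Uy; rewrite (partialM i (dF y Uy) (dG y Uy)) FF' // GG'.
- move=> F a F0 cF [dF IF].
  have D y v Uy := derive_comp v (dF y Uy) (is_derive1_powR a (F0 y Uy)).
  split=> [y Uy|i]; first exact: (D y 0 Uy).1.
  have [F' cF' FF'] := IF i.
  (* The exponent drops to [a - 1], so the closure has to admit all real exponents at once. *)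
  exists (fun z => a * F z `^ (a - 1) * F' z).
    by do 2![apply: SCmul => //]; [exact: SCcst|exact: SCpow].
  by move=> y Uy; rewrite -FF' //; exact: (D y _ Uy).2.
- move=> F F0 cF [dF IF]; split=> [y Uy|i].
    exact (differentiableV (dF y Uy) (F0 y Uy)).
  have [F' cF' FF'] := IF i.
  exists (fun z => (-1) * ((F z)^-1 * (F z)^-1) * F' z).
    by do 2![apply: SCmul => //]; [exact: SCcst|by apply: SCmul; exact: SCinv].
  move=> y Uy; rewrite -FF' //.
  have := deriveV (F0 y Uy) (@diff_derivable _ _ _ _ _ (delta_mx 0 i) (dF y Uy)).
  by rewrite mulN1r -invfM -expr2; exact.
Qed.

Lemma smooth_onD U F G : open U -> smooth_on U F -> smooth_on U G ->
  smooth_on U (fun z => F z + G z).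
Proof. by move=> oU *; apply: smooth_closureP oU _; apply: SCadd; exact: SCsmooth. Qed.

Lemma smooth_onM U F G : open U -> smooth_on U F -> smooth_on U G ->
  smooth_on U (fun z => F z * G z).
Proof. by move=> oU *; apply: smooth_closureP oU _; apply: SCmul; exact: SCsmooth. Qed.

Lemma smooth_on_cst U (a : R) : open U -> smooth_on U (fun=> a).
Proof. by move=> oU; apply: smooth_closureP oU _; exact: SCcst. Qed.

Lemma smooth_on_powR U F a : open U -> (forall z, U z -> 0 < F z) ->
  smooth_on U F -> smooth_on U (fun z => F z `^ a).
Proof. by move=> oU *; apply: smooth_closureP oU _; apply: SCpow => //; exact: SCsmooth. Qed.

Lemma smooth_onV U F : open U -> (forall z, U z -> F z != 0) ->
  smooth_on U F -> smooth_on U (fun z => (F z)^-1).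
Proof. by move=> oU *; apply: smooth_closureP oU _; apply: SCinv => //; exact: SCsmooth. Qed.

Lemma eq_smooth_on U F G : open U -> (forall z, U z -> F z = G z) ->
  smooth_on U F -> smooth_on U G.
Proof.
move=> oU FG sF s y Uy; have E := eq_on_partials s oU FG.
by apply: near_differentiable (sF s y Uy); apply: (open_near oU Uy) => z /E.
Qed.

Lemma smooth_on_sum U (I : Type) (r : seq I) (P : pred I) (F : I -> 'rV[R]_n -> R) :
  open U -> (forall i, smooth_on U (F i)) -> smooth_on U (fun z => \sum_(i <- r | P i) F i z).
Proof.
move=> oU sF; elim: r => [|i r IH].
  by apply: eq_smooth_on (smooth_on_cst 0 oU) => // z _; rewrite big_nil.
case Pi: (P i).
  by apply: eq_smooth_on (smooth_onD oU (sF i) IH) => // z _; rewrite big_cons Pi.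
by apply: eq_smooth_on IH => // z _; rewrite big_cons Pi.
Qed.

Lemma smooth_on_prod U (I : Type) (r : seq I) (P : pred I) (F : I -> 'rV[R]_n -> R) :
  open U -> (forall i, smooth_on U (F i)) -> smooth_on U (fun z => \prod_(i <- r | P i) F i z).
Proof.
move=> oU sF; elim: r => [|i r IH].
  by apply: eq_smooth_on (smooth_on_cst 1 oU) => // z _; rewrite big_nil.
case Pi: (P i).
  by apply: eq_smooth_on (smooth_onM oU (sF i) IH) => // z _; rewrite big_cons Pi.
by apply: eq_smooth_on IH => // z _; rewrite big_cons Pi.
Qed.

(** The Leibniz formula is polynomial in the entries. *)
Lemma smooth_on_det U m (A : 'rV[R]_n -> 'M[R]_m) : open U ->
  (forall i j, smooth_on U (fun z => A z i j)) -> smooth_on U (fun z => \det (A z)).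
Proof.
move=> oU sA; apply: smooth_on_sum => // s.
by apply: smooth_onM => //; [exact: smooth_on_cst|exact: smooth_on_prod].
Qed.

(** Cramer's rule: the entries are cofactors divided by the determinant. *)
Lemma smooth_on_invmx U m (A : 'rV[R]_n -> 'M[R]_m) : open U ->
  (forall z, U z -> A z \in unitmx) ->
  (forall i j, smooth_on U (fun z => A z i j)) ->
  forall i j, smooth_on U (fun z => invmx (A z) i j).
Proof.
move=> oU uA sA i j.
apply: (@eq_smooth_on U (fun z => (\det (A z))^-1 * cofactor (A z) j i)) => //.
  by move=> z Uz; rewrite /invmx uA // !mxE.
apply: smooth_onM => //.
  apply: smooth_onV => // [z Uz|]; last exact: smooth_on_det.
  by have := uA z Uz; rewrite unitmxE unitfE.
apply: smooth_onM => //; first exact: smooth_on_cst.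
apply: smooth_on_det => // k l.
by apply: eq_smooth_on (sA (lift j k) (lift i l)) => // z _; rewrite !mxE.
Qed.

Lemma partialC U F i j y : open U -> smooth_on U F -> U y ->
  partial i (partial j F) y = partial j (partial i F) y.
Proof.
move=> oU sF Uy; have sP k := smooth_on_partial k sF.
apply: derive_comm.
- by apply: (open_near oU Uy) => z; exact (smooth_on_diff sF).
- by apply: (open_near oU Uy) => z; exact (smooth_on_diff (sP _)).
- by apply: (open_near oU Uy) => z; exact (smooth_on_diff (sP _)).
- exact (differentiable_continuous (smooth_on_diff (smooth_on_partial _ (sP _)) Uy)).
- exact (differentiable_continuous (smooth_on_diff (smooth_on_partial _ (sP _)) Uy)).
Qed.

Lemma partial_powR i F a y : 0 < F y -> differentiable F y ->
  partial i (fun z => F z `^ a) y = a * F y `^ (a - 1) * partial i F y.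
Proof. by move=> F0 dF; exact: (derive_comp _ dF (is_derive1_powR a F0)).2. Qed.

Lemma partial_comp m i (G : 'rV[R]_m -> R) (f : 'rV[R]_n -> 'rV[R]_m) y :
  (forall k, differentiable (fun z => f z 0 k) y) -> differentiable G (f y) ->
  partial i (fun z => G (f z)) y =
    \sum_(k < m) partial i (fun z => f z 0 k) y * partial k G (f y).
Proof.
move=> df dG.
(* Differentiability is assumed for the components only; the expansion in the standard basis passes
   it to [f]. *)
have Ef : f = \sum_(k < m) (fun z => f z 0 k *: delta_mx 0 k).
  by apply/funext => z; rewrite fct_sumE {1}[f z]row_sum_delta.
have dfk k : differentiable (fun z => f z 0 k *: (delta_mx 0 k : 'rV[R]_m)) y.
  exact (differentiableZl (delta_mx 0 k) (df k)).
have dfy : differentiable f y.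
  by rewrite Ef; exact: differentiable_sum.
have d := differentiable_comp dfy dG.
rewrite /partial; have := deriveE (delta_mx 0 i) d; rewrite /comp => ->.
have /(congr1 (fun h => h (delta_mx 0 i))) /= := diff_comp dfy dG.
rewrite /comp => ->.
have -> : 'd f y (delta_mx 0 i) =
    \sum_(k < m) 'D_(delta_mx 0 i) (fun z => f z 0 k) y *: delta_mx 0 k.
  rewrite -(deriveE _ dfy) {1}Ef derive_sum; last by move=> k; exact: diff_derivable.
  apply: eq_bigr => k _.
  rewrite (deriveE _ (dfk k)) (deriveE _ (df k)).
  by rewrite (diffZl (delta_mx 0 k) (df k)).
rewrite linear_sum; apply: eq_bigr => k _.
by rewrite linearZ /= (deriveE _ dG).
Qed.

End Euclid.

(** * Riemannian geometry in one chart *)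

(* What local Riemannian geometry needs from the partial derivatives in a chart.
   Keeping [dd] abstract also prevents the kernel and the tactics from unfolding
   iterated derivatives. *)
Record calculus (R : realType) (n : nat) (T : Type) (W : set T) := Calculus {
  smooth : (T -> R) -> Prop;
  dd : 'I_n -> (T -> R) -> T -> R;
  smooth_cst : forall a, smooth (fun=> a);
  smoothD : forall F G, smooth F -> smooth G -> smooth (fun z => F z + G z);
  smoothM : forall F G, smooth F -> smooth G -> smooth (fun z => F z * G z);
  smooth_dd : forall i F, smooth F -> smooth (dd i F);
  eq_smooth : forall F G, (forall z, W z -> F z = G z) -> smooth F -> smooth G;
  dd_cst : forall i a x, W x -> dd i (fun=> a) x = 0;
  ddD : forall i F G x, smooth F -> smooth G -> W x ->
    dd i (fun z => F z + G z) x = dd i F x + dd i G x;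
  ddM : forall i F G x, smooth F -> smooth G -> W x ->
    dd i (fun z => F z * G z) x = dd i F x * G x + F x * dd i G x;
  eq_dd : forall i F G x, (forall z, W z -> F z = G z) -> W x ->
    dd i F x = dd i G x;
  ddC : forall i j F x, smooth F -> W x -> dd i (dd j F) x = dd j (dd i F) x
}.

Section LocalGeometry.
Context {R : realType} {n : nat} {T : Type} {W : set T} (C : calculus R n W).
Context (g : T -> 'M[R]_n).
Hypothesis smooth_g : forall i j, smooth C (fun z => g z i j).
Hypothesis smooth_invg : forall i j, smooth C (fun z => invmx (g z) i j).
Hypothesis g_sym : forall z, W z -> (g z)^T = g z.
Hypothesis g_unit : forall z, W z -> g z \in unitmx.

Local Notation D := (dd C).
Implicit Types (F G a b : T -> R) (x z : T).

Lemma smooth_sum (I : Type) (r : seq I) (F : I -> T -> R) :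
  (forall i, smooth C (F i)) -> smooth C (fun z => \sum_(i <- r) F i z).
Proof.
move=> sF; elim: r => [|i r IH].
  by apply: eq_smooth (smooth_cst C 0) => z _; rewrite big_nil.
by apply: eq_smooth (smoothD (sF i) IH) => z _; rewrite big_cons.
Qed.

Lemma dd_sum (I : Type) (r : seq I) (F : I -> T -> R) i x :
  (forall k, smooth C (F k)) -> W x ->
  D i (fun z => \sum_(k <- r) F k z) x = \sum_(k <- r) D i (F k) x.
Proof.
move=> sF Wx; elim: r => [|k r IH].
  rewrite big_nil; apply: etrans (dd_cst C i 0 Wx).
  by apply: eq_dd => // z _; rewrite big_nil.
rewrite big_cons -IH -ddD //; last exact: smooth_sum.
by apply: eq_dd => // z _; rewrite big_cons.
Qed.

Lemma metricC z i j : W z -> g z i j = g z j i.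
Proof. by move=> Wz; rewrite -{1}(g_sym Wz) mxE. Qed.

Lemma invmetricC z i j : W z -> invmx (g z) i j = invmx (g z) j i.
Proof. by move=> Wz; rewrite -{1}(g_sym Wz) -trmx_inv mxE. Qed.

Lemma metricK z (X : 'I_n -> R) i : W z ->
  \sum_j g z i j * (\sum_k invmx (g z) j k * X k) = X i.
Proof.
move=> Wz; transitivity ((g z *m (invmx (g z) *m \col_k X k)) i 0).
  rewrite mxE; apply: eq_bigr => j _; rewrite mxE; congr (_ * _).
  by apply: eq_bigr => k _; rewrite !mxE.
by rewrite mulKVmx ?g_unit // mxE.
Qed.

Lemma invmetricK z (X : 'I_n -> R) i : W z ->
  \sum_j invmx (g z) i j * (\sum_k g z j k * X k) = X i.
Proof.
move=> Wz; transitivity ((invmx (g z) *m (g z *m \col_k X k)) i 0).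
  rewrite mxE; apply: eq_bigr => j _; rewrite mxE; congr (_ * _).
  by apply: eq_bigr => k _; rewrite !mxE.
by rewrite mulKmx ?g_unit // mxE.
Qed.

(** * Gradient, Levi-Civita connection, Hessian and divergence in coordinates *)

Definition lgrad F (k : 'I_n) z := \sum_l invmx (g z) k l * D l F z.

(* <grad F, grad G> *)
Definition lip F G z := \sum_k lgrad F k z * D k G z.

(* Christoffel symbols of the first kind. *)
Definition Gl (l i j : 'I_n) z := 2^-1 *
  (D i (fun y => g y j l) z + D j (fun y => g y i l) z - D l (fun y => g y i j) z).

Definition Gam (k i j : 'I_n) z := 2^-1 * \sum_l invmx (g z) k l *
  (D i (fun y => g y j l) z + D j (fun y => g y i l) z - D l (fun y => g y i j) z).

Definition lhess F (i j : 'I_n) z := D i (D j F) z - \sum_k Gam k i j z * D k F z.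

Definition llap F z := \sum_i \sum_j invmx (g z) i j * lhess F i j z.

Definition ldiv (X : 'I_n -> T -> R) z :=
  \sum_i (D i (X i) z + \sum_j Gam i i j z * X j z).

(* The component of the vector field nabla_i (grad F) along d_k. *)
Definition covd F (i k : 'I_n) z :=
  D i (lgrad F k) z + \sum_m Gam k i m z * lgrad F m z.

(** [ricci] with [curvature] written out. *)
Definition lricci (j k : 'I_n) z := \sum_i
  (D i (Gam i j k) z - D j (Gam i i k) z
   + \sum_m (Gam i i m z * Gam m j k z - Gam i j m z * Gam m i k z)).

Lemma smooth_lgrad F k : smooth C F -> smooth C (lgrad F k).
Proof.
by move=> sF; apply: smooth_sum => l; apply: smoothM => //; exact: smooth_dd.
Qed.

Lemma smooth_lip F G : smooth C F -> smooth C G -> smooth C (lip F G).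
Proof.
move=> sF sG; apply: smooth_sum => k; apply: smoothM; first exact: smooth_lgrad.
exact: smooth_dd.
Qed.

Lemma smoothN F : smooth C F -> smooth C (fun z => - F z).
Proof.
move=> sF; apply: eq_smooth (smoothM (smooth_cst C (-1)) sF) => z _.
by rewrite mulN1r.
Qed.

Lemma smooth_Gam k i j : smooth C (Gam k i j).
Proof.
apply: smoothM; first exact: smooth_cst.
apply: smooth_sum => l; apply: smoothM => //; apply: smoothD.
  by apply: smoothD; exact: smooth_dd.
by apply: smoothN; exact: smooth_dd.
Qed.

Lemma smooth_covd F i k : smooth C F -> smooth C (covd F i k).
Proof.
move=> sF; apply: smoothD; first by apply: smooth_dd; exact: smooth_lgrad.
by apply: smooth_sum => m; apply: smoothM; [exact: smooth_Gam|exact: smooth_lgrad].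
Qed.

Lemma smooth_llap F : smooth C F -> smooth C (llap F).
Proof.
move=> sF; do 2 apply: smooth_sum => ?; apply: smoothM => //.
apply: smoothD; first by do 2 apply: smooth_dd.
apply: smoothN; apply: smooth_sum => m.
by apply: smoothM; [exact: smooth_Gam|exact: smooth_dd].
Qed.

Lemma metric_Gam l i j z : W z -> \sum_m g z l m * Gam m i j z = Gl l i j z.
Proof.
move=> Wz; rewrite -(metricK (fun l => Gl l i j z) l Wz).
apply: eq_bigr => m _; congr (_ * _).
by rewrite /Gam mulr_sumr; apply: eq_bigr => k _; rewrite /Gl mulrCA.
Qed.

Lemma metric_lgrad F j z : W z -> \sum_k g z j k * lgrad F k z = D j F z.
Proof. by move=> Wz; rewrite (metricK (fun k => D k F z)). Qed.

(** Compatibility of the connection with the metric, in terms of symbols of the first kind. *)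
Lemma Gl_dd l i k z : W z -> Gl l i k z + Gl k i l z = D i (fun y => g y l k) z.
Proof.
move=> Wz; rewrite /Gl.
have E p q r : D p (fun y => g y q r) z = D p (fun y => g y r q) z.
  by apply: eq_dd => // y Wy; exact: metricC.
rewrite (E i k l) (E k i l) (E l i k).
by field.
Qed.

(** Torsion-freeness, a consequence of the symmetry of the metric. *)
Lemma GamC k i j z : W z -> Gam k i j z = Gam k j i z.
Proof.
move=> Wz; rewrite /Gam; congr (_ * _); apply: eq_bigr => l _; congr (_ * _).
rewrite [D i _ z + _]addrC; congr (_ - _).
by apply: eq_dd => // y Wy; exact: metricC.
Qed.

Lemma lhessC F i j z : smooth C F -> W z -> lhess F i j z = lhess F j i z.
Proof.
move=> sF Wz; rewrite /lhess ddC //; congr (_ - _).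
by apply: eq_bigr => k _; rewrite GamC.
Qed.

Lemma Gam_dd F i j z : W z ->
  \sum_k Gam k i j z * D k F z = \sum_l Gl l i j z * lgrad F l z.
Proof.
move=> Wz; under eq_bigr => k _ do rewrite -(metric_lgrad F k Wz) mulr_sumr.
rewrite exchange_big; apply: eq_bigr => l _ /=.
rewrite -metric_Gam // mulr_suml; apply: eq_bigr => k _.
by rewrite mulrA (metricC k l Wz) [X in X * _]mulrC.
Qed.

(** Covariant differentiation commutes with lowering an index: differentiate [metric_lgrad] and
    absorb the derivative of the metric by [Gl_dd]. *)
Lemma metric_covd F i j z : smooth C F -> W z ->
  \sum_k g z j k * covd F i k z = lhess F i j z.
Proof.
move=> sF Wz.
have E : D i (D j F) z = \sum_k (D i (fun y => g y j k) z * lgrad F k z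
                                 + g z j k * D i (lgrad F k) z).
  rewrite -(@eq_dd _ _ _ _ C i (fun y => \sum_k g y j k * lgrad F k y)) //.
    rewrite dd_sum // => [|k]; last by apply: smoothM => //; exact: smooth_lgrad.
    by apply: eq_bigr => k _; rewrite ddM //; exact: smooth_lgrad.
  by move=> y Wy; rewrite metric_lgrad.
rewrite /lhess E Gam_dd //.
under eq_bigr => k _ do rewrite /covd mulrDr mulr_sumr.
rewrite !big_split /= [\sum_k \sum_m _]exchange_big /=.
have -> : \sum_m \sum_k g z j k * (Gam k i m z * lgrad F m z) =
   \sum_m Gl j i m z * lgrad F m z.
  apply: eq_bigr => m _; rewrite -metric_Gam // mulr_suml.
  by apply: eq_bigr => k _; rewrite mulrA.
have -> : \sum_k D i (fun y => g y j k) z * lgrad F k z =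
   \sum_m Gl j i m z * lgrad F m z + \sum_m Gl m i j z * lgrad F m z.
  by rewrite -big_split; apply: eq_bigr => m _ /=; rewrite -mulrDl Gl_dd.
ring.
Qed.

Lemma covdE F i k z : smooth C F -> W z ->
  covd F i k z = \sum_j invmx (g z) k j * lhess F i j z.
Proof.
move=> sF Wz; rewrite -(invmetricK (fun k => covd F i k z) k Wz).
by apply: eq_bigr => j _; rewrite metric_covd.
Qed.

(** The product rule on [lgrad F k * D k G] is completed by Christoffel terms to [covd F] and
    [lhess G]; these enter with opposite signs and cancel. *)
Lemma dd_lip F G i z : smooth C F -> smooth C G -> W z ->
  D i (lip F G) z =
  \sum_j (lhess F i j z * lgrad G j z + lhess G i j z * lgrad F j z).
Proof.
move=> sF sG Wz; rewrite dd_sum // => [|k]; last first.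
  by apply: smoothM; [exact: smooth_lgrad|exact: smooth_dd].
under [LHS]eq_bigr => k _ do rewrite (ddM _ (smooth_lgrad k sF) (smooth_dd k sG) Wz).
rewrite !big_split /=.
have -> : \sum_j lhess F i j z * lgrad G j z = \sum_k covd F i k z * D k G z.
  under eq_bigr => j _ do rewrite -metric_covd // mulr_suml.
  rewrite exchange_big; apply: eq_bigr => k _ /=.
  rewrite -(metric_lgrad G k Wz) mulr_sumr; apply: eq_bigr => j _.
  by rewrite (metricC j k Wz); ring.
have -> : \sum_j lhess G i j z * lgrad F j z =
  \sum_k lgrad F k z * D i (D k G) z
  - \sum_k (\sum_m Gam k i m z * lgrad F m z) * D k G z.
  under [X in _ - X]eq_bigr => k _ do rewrite mulr_suml.
  rewrite [X in _ - X]exchange_big -sumrB; apply: eq_bigr => j _ /=.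
  rewrite /lhess mulrBl mulr_suml [X in X - _]mulrC; congr (_ - _).
  by apply: eq_bigr => k _; ring.
under [X in _ = X + _]eq_bigr => k _ do rewrite /covd mulrDl.
rewrite big_split /=; ring.
Qed.

Lemma lip_lip F G a z : smooth C F -> smooth C G -> W z ->
  lip a (lip F G) z = \sum_i \sum_j lhess F i j z * lgrad a i z * lgrad G j z
    + \sum_i \sum_j lhess G i j z * lgrad a i z * lgrad F j z.
Proof.
move=> sF sG Wz; rewrite /lip -big_split; apply: eq_bigr => i _ /=.
rewrite -/(lip F G) dd_lip // mulr_sumr -big_split; apply: eq_bigr => j _ /=.
ring.
Qed.

(** By [lip_lip] the right-hand side is a sum of six Hessian contractions. By symmetry those of [a]
    and of [b] cancel, and that of [F] occurs twice. *)
Lemma lhess_polarization F a b z :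
  smooth C F -> smooth C a -> smooth C b -> W z ->
  2 * (\sum_i \sum_j lhess F i j z * lgrad a i z * lgrad b j z) =
  lip a (lip F b) z + lip b (lip F a) z - lip F (lip a b) z.
Proof.
move=> sF sa sb Wz; rewrite !lip_lip //.
have S H c d : smooth C H -> \sum_i \sum_j lhess H i j z * lgrad c i z * lgrad d j z
    = \sum_i \sum_j lhess H i j z * lgrad d i z * lgrad c j z.
  move=> sH; rewrite exchange_big; apply: eq_bigr => i _ /=; apply: eq_bigr => j _.
  by rewrite lhessC // mulrAC.
rewrite (S F b a) // (S b F a) // (S a F b) //; ring.
Qed.

Lemma ldiv_lgrad F z : smooth C F -> W z -> ldiv (lgrad F) z = llap F z.
Proof.
move=> sF Wz; apply: eq_bigr => i _.
by rewrite -[LHS]/(covd F i i z) covdE.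
Qed.

Lemma llap_covd F z : smooth C F -> W z -> llap F z = \sum_i covd F i i z.
Proof. by move=> sF Wz; apply: eq_bigr => i _; rewrite covdE. Qed.

Lemma ldivM q (X : 'I_n -> T -> R) z : smooth C q -> (forall i, smooth C (X i)) ->
  W z -> ldiv (fun i y => q y * X i y) z = q z * ldiv X z + \sum_i X i z * D i q z.
Proof.
move=> sq sX Wz; rewrite /ldiv mulr_sumr -big_split; apply: eq_bigr => i _ /=.
rewrite ddM // mulrDr mulr_sumr.
under [X in _ + X = _]eq_bigr => j _ do rewrite mulrCA.
ring.
Qed.

Lemma ldivD (X Y : 'I_n -> T -> R) z : (forall i, smooth C (X i)) ->
  (forall i, smooth C (Y i)) -> W z ->
  ldiv (fun i y => X i y + Y i y) z = ldiv X z + ldiv Y z.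
Proof.
move=> sX sY Wz; rewrite /ldiv -big_split; apply: eq_bigr => i _ /=.
rewrite ddD //; under eq_bigr => j _ do rewrite mulrDr.
by rewrite big_split /=; ring.
Qed.

Lemma eq_ldiv (X Y : 'I_n -> T -> R) z : (forall i y, W y -> X i y = Y i y) ->
  W z -> ldiv X z = ldiv Y z.
Proof.
move=> XY Wz; apply: eq_bigr => i _; congr (_ + _).
  by apply: eq_dd => // y; exact: XY.
by apply: eq_bigr => j _; rewrite XY.
Qed.

(** * Bochner's formula *)

Lemma dd_covd F i j k z : smooth C F -> W z ->
  D i (covd F j k) z = D i (D j (lgrad F k)) z
   + \sum_m (D i (Gam k j m) z * lgrad F m z + Gam k j m z * D i (lgrad F m) z).
Proof.
move=> sF Wz.
have sX m := smooth_lgrad m sF.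
have sGX m : smooth C (fun y => Gam k j m y * lgrad F m y).
  by apply: smoothM; [exact: smooth_Gam|exact: sX].
rewrite ddD //; [|exact: smooth_dd|exact: smooth_sum].
rewrite dd_sum //; congr (_ + _); apply: eq_bigr => m _.
by rewrite ddM //; exact: smooth_Gam.
Qed.

(* The commutation [nabla_k nabla_j X^k = nabla_j nabla_k X^k + Ric_jm X^m]
   contracted with X = grad F, where the left-hand side is written out. *)
Lemma bochner_commutation F j z : smooth C F -> W z ->
  \sum_k D k (covd F j k) z + \sum_k \sum_i Gam k k i z * covd F j i z
   - \sum_k \sum_m covd F m k z * Gam m k j z
  = D j (llap F) z + \sum_m lricci j m z * lgrad F m z.
Proof.
move=> sF Wz.
have sX m := smooth_lgrad m sF.
rewrite (@eq_dd _ _ _ _ C j _ (fun y => \sum_k covd F k k y)) //; last first.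
  by move=> y Wy; exact: llap_covd.
rewrite dd_sum // => [|k]; last exact: smooth_covd.
under eq_bigr => k _ do rewrite dd_covd //.
(* After [ddC] the second derivatives of [lgrad F] agree on both sides; only terms with Christoffel
   symbols or their first derivatives remain. *)
under [in RHS]eq_bigr => k _ do rewrite dd_covd // ddC //.
(* The next three expansions bring the terms quadratic in the Christoffel symbols to common triple
   sums, which [ring] then treats as atoms. *)
have -> : \sum_k \sum_m covd F m k z * Gam m k j z =
  \sum_k \sum_m Gam k j m z * D k (lgrad F m) z +
  \sum_m \sum_k \sum_l Gam k j l z * Gam l k m z * lgrad F m z.
  transitivity (\sum_k \sum_m (D m (lgrad F k) z * Gam m k j z) +
    \sum_k \sum_m (\sum_l Gam k m l z * lgrad F l z) * Gam m k j z).
    rewrite -big_split; apply: eq_bigr => k _; rewrite -big_split.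
    by apply: eq_bigr => m _; rewrite /covd mulrDl.
  congr (_ + _).
    rewrite exchange_big; apply: eq_bigr => k _ /=; apply: eq_bigr => m _.
    by rewrite (GamC k m j) // mulrC.
  transitivity (\sum_k \sum_m \sum_l Gam k m l z * lgrad F l z * Gam m k j z).
    by do 2 apply: eq_bigr => ? _; rewrite mulr_suml.
  under eq_bigr => k _ do rewrite exchange_big.
  rewrite exchange_big; apply: eq_bigr => l _ /=.
  rewrite exchange_big; apply: eq_bigr => m _ /=; apply: eq_bigr => k _.
  by rewrite (GamC m k j) //; ring.
have -> : \sum_k \sum_i Gam k k i z * covd F j i z =
  \sum_k \sum_m Gam k k m z * D j (lgrad F m) z +
  \sum_m \sum_k \sum_l Gam k k l z * Gam l j m z * lgrad F m z.
  rewrite [X in _ + X]exchange_big -big_split; apply: eq_bigr => k _ /=.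
  rewrite [X in _ + X]exchange_big -big_split; apply: eq_bigr => i _ /=.
  rewrite /covd mulrDr mulr_sumr; congr (_ + _).
  by apply: eq_bigr => m _; rewrite mulrA.
have -> : \sum_m lricci j m z * lgrad F m z =
  \sum_k \sum_m D k (Gam k j m) z * lgrad F m z
  - \sum_k \sum_m D j (Gam k k m) z * lgrad F m z
  + \sum_m \sum_k \sum_l Gam k k l z * Gam l j m z * lgrad F m z
  - \sum_m \sum_k \sum_l Gam k j l z * Gam l k m z * lgrad F m z.
  rewrite [X in X - _ + _ - _]exchange_big [X in _ - X + _ - _]exchange_big /=.
  rewrite -sumrB -big_split -sumrB; apply: eq_bigr => m _ /=.
  rewrite /lricci mulr_suml -sumrB -big_split -sumrB; apply: eq_bigr => k _ /=.
  rewrite !mulrDl mulNr -!addrA; congr (_ + (_ + _)).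
  by rewrite -sumrB mulr_suml; apply: eq_bigr => l _; rewrite mulrBl.
under [X in _ = X + _]eq_bigr => k _ do rewrite big_split.
under eq_bigr => k _ do rewrite big_split.
rewrite !big_split /=; ring.
Qed.

(** For X = grad F, symmetry of the Hessian gives grad |X|^2 = 2 V with V = nabla_X X. The
    divergence of V is the trace of (nabla X)^2 plus X^j nabla_k nabla_j X^k, and
    [bochner_commutation] treats the latter. *)
Lemma bochner F z : smooth C F -> W z ->
  2^-1 * ldiv (lgrad (lip F F)) z =
  \sum_j \sum_k covd F j k z * covd F k j z
  + \sum_j lgrad F j z * D j (llap F) z
  + \sum_j \sum_m lricci j m z * lgrad F j z * lgrad F m z.
Proof.
move=> sF Wz.
have sX m := smooth_lgrad m sF.
pose V k y := \sum_j covd F j k y * lgrad F j y.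
have sV k : smooth C (V k).
  by apply: smooth_sum => j; apply: smoothM; [exact: smooth_covd|].
have VE k y : W y -> lgrad (lip F F) k y = 2 * V k y.
  move=> Wy; rewrite /lgrad.
  under eq_bigr => l _ do rewrite dd_lip // mulr_sumr.
  rewrite exchange_big mulr_sumr; apply: eq_bigr => j _ /=.
  rewrite covdE // mulr_suml mulr_sumr; apply: eq_bigr => l _ /=.
  rewrite (lhessC j l) //; ring.
rewrite (@eq_ldiv _ (fun k y => 2 * V k y)) //.
rewrite (ldivM (smooth_cst C 2)) //.
rewrite [X in _ + X]big1 => [|i _]; last by rewrite dd_cst // mulr0.
rewrite addr0 mulKf ?pnatr_eq0 //.
have -> : ldiv V z = \sum_k \sum_j covd F j k z * D k (lgrad F j) z
  + \sum_j lgrad F j z * (\sum_k D k (covd F j k) z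
       + \sum_k \sum_i Gam k k i z * covd F j i z).
  rewrite /ldiv.
  have DV k : D k (V k) z = \sum_j
      (D k (covd F j k) z * lgrad F j z + covd F j k z * D k (lgrad F j) z).
    rewrite dd_sum // => [|j]; last by apply: smoothM; [exact: smooth_covd|].
    by apply: eq_bigr => j _; rewrite (ddM _ (smooth_covd j k sF) (sX j) Wz).
  under eq_bigr => k _ do rewrite DV.
  under [X in _ = _ + X]eq_bigr => j _ do rewrite mulrDr !mulr_sumr.
  rewrite !big_split /=.
  have -> : \sum_k \sum_j lgrad F k z * D j (covd F k j) z =
     \sum_k \sum_j D k (covd F j k) z * lgrad F j z.
    by rewrite exchange_big; do 2 apply: eq_bigr => ? _ /=; rewrite mulrC.
  have -> : \sum_i \sum_j Gam i i j z * V j z = 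
     \sum_j \sum_k lgrad F j z * \sum_i Gam k k i z * covd F j i z.
    rewrite [RHS]exchange_big; apply: eq_bigr => k _ /=.
    under [RHS]eq_bigr => j _ do rewrite mulr_sumr.
    rewrite [RHS]exchange_big; apply: eq_bigr => i _ /=.
    by rewrite /V mulr_sumr; apply: eq_bigr => j _; ring.
  under eq_bigr => k _ do rewrite big_split /=.
  rewrite big_split /=; ring.
(* Completing [D k (lgrad F j)] to [covd F k j] costs exactly the subtracted Christoffel term on the
   left of [bochner_commutation]. *)
have -> : \sum_k \sum_j covd F j k z * D k (lgrad F j) z =
  \sum_j \sum_k covd F j k z * covd F k j z
  - \sum_j lgrad F j z * \sum_k \sum_m covd F m k z * Gam m k j z.
  have -> : \sum_j lgrad F j z * \sum_k \sum_m covd F m k z * Gam m k j z =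
     \sum_j \sum_k covd F j k z * \sum_m Gam j k m z * lgrad F m z.
    transitivity (\sum_j \sum_k \sum_m covd F m k z * (Gam m k j z * lgrad F j z)).
      apply: eq_bigr => j _; rewrite mulr_sumr; apply: eq_bigr => k _.
      by rewrite mulr_sumr; apply: eq_bigr => m _; ring.
    rewrite exchange_big [RHS]exchange_big; apply: eq_bigr => k _ /=.
    rewrite exchange_big; apply: eq_bigr => j _ /=.
    by rewrite mulr_sumr.
  rewrite exchange_big -sumrB; apply: eq_bigr => j _ /=.
  rewrite -sumrB; apply: eq_bigr => k _ /=.
  by rewrite -mulrBr [in RHS]/covd addrK.
rewrite -!addrA; congr (_ + _).
rewrite addrC -sumrB -big_split; apply: eq_bigr => j _ /=.
rewrite -mulrBr bochner_commutation // mulrDr; congr (_ + _).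
by rewrite mulr_sumr; apply: eq_bigr => m _; ring.
Qed.

(** Raising one index of each factor turns the Hessian into [covd]; by symmetry, its squared norm is
    the trace of the square of that endomorphism. *)
Lemma hess_normsqE F z : smooth C F -> W z ->
  \sum_i \sum_j \sum_k \sum_l
    invmx (g z) i k * invmx (g z) j l * lhess F i j z * lhess F k l z
  = \sum_j \sum_k covd F j k z * covd F k j z.
Proof.
move=> sF Wz; apply: eq_bigr => i _.
under eq_bigr => j _ do rewrite exchange_big.
rewrite exchange_big; apply: eq_bigr => l _ /=.
rewrite !covdE // mulr_suml; apply: eq_bigr => j _.
rewrite mulr_sumr; apply: eq_bigr => k _.
by rewrite (invmetricC l j) // (lhessC l k) //; ring.
Qed.

(** The field is [q] grad w plus [- 2 * llap F] times a field with zero divergence at [z]. The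
    latter product thus contributes only a derivative of [llap F], which cancels the third-order
    term of [bochner]. *)
Lemma bochner_weighted F q z : smooth C F -> smooth C q -> W z ->
  ldiv (fun k y => q y * lgrad F k y) z = 0 ->
  2^-1 * ldiv (fun k y => q y * (lgrad (lip F F) k y - 2 * llap F y * lgrad F k y)) z =
  2^-1 * \sum_i lgrad (lip F F) i z * D i q z
  + q z * (\sum_j \sum_k covd F j k z * covd F k j z
           + \sum_j \sum_m lricci j m z * lgrad F j z * lgrad F m z).
Proof.
move=> sF sq Wz eqn.
have sX m := smooth_lgrad m sF.
have sL := smooth_llap sF.
have sY m := smooth_lgrad m (smooth_lip sF sF).
have s2 := smoothM (smooth_cst C (- 2)) sL.
have sqX m := smoothM sq (sX m).
rewrite (@eq_ldiv _ (fun k y => q y * lgrad (lip F F) k y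
    + (-2 * llap F y) * (q y * lgrad F k y))) //; last by move=> k y _; ring.
rewrite ldivD // => [|i|i]; [|exact: smoothM|exact: smoothM].
rewrite ldivM // (ldivM s2 sqX Wz) eqn mulr0 add0r.
under [X in _ * (_ + X)]eq_bigr => i _.
  rewrite ddM //; last exact: smooth_cst.
  rewrite dd_cst // mul0r add0r.
  over.
have -> : \sum_i q z * lgrad F i z * (-2 * D i (llap F) z) =
  - (2 * (q z * \sum_i lgrad F i z * D i (llap F) z)).
  by rewrite !mulr_sumr -sumrN; apply: eq_bigr => i _; ring.
have := bochner sF Wz.
set S := \sum_i lgrad F i z * _; set B := ldiv _ _.
set H := \sum_j \sum_k _; set P := \sum_j \sum_m _ => E.
have -> : B = 2 * (H + S + P) by rewrite -E mulrA divff ?mul1r // pnatr_eq0.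
by field.
Qed.

End LocalGeometry.

(** * Change of charts *)

Section ChartCalculus.
Context {R : realType} {n : nat} {M : manifold R n}.
Implicit Types (c d : chart M) (W : set M) (F G : M -> R).

(** * Calculus of partial derivatives in a chart *)

Definition chart_img c W : set 'rV[R]_n := chart_map c @` (chart_dom c `&` W).

(** The set is the preimage of [W] under [chart_inv c], which is continuous on the open image of the
    chart. *)
Lemma open_chart_img c W : open W -> open (chart_img c W).
Proof.
move=> oW; have oI := @chart_img_open _ _ M c.
have -> : chart_img c W = (chart_map c @` chart_dom c) `&` chart_inv c @^-1` W.
  apply/seteqP; split=> [_ [x [cx Wx] <-]|_ [[x cx <-]]] /=.
    by split; [exists x|rewrite chart_mapK].
  by rewrite chart_mapK // => Wx; exists x.
have := @chart_inv_continuous _ _ M c; rewrite continuous_open_subspace //.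
by move=> /(continuous_inP (chart_inv c) oI); apply.
Qed.

Lemma eq_on_chart_img c W F G : (forall x, (chart_dom c `&` W) x -> F x = G x) ->
  forall y, chart_img c W y -> (F \o chart_inv c) y = (G \o chart_inv c) y.
Proof. by move=> FG _ [x [cx Wx] <-] /=; rewrite chart_mapK // FG. Qed.

(** The condition of [msmooth_on W F] at the single chart [c]. *)
Definition chart_smooth c W F := smooth_on (chart_img c W) (F \o chart_inv c).

Lemma chart_smooth_sub c W W' F : W' `<=` W -> chart_smooth c W F -> chart_smooth c W' F.
Proof.
by move=> WW; apply: smooth_on_sub => _ [x [cx /WW Wx] <-]; exists x.
Qed.

Lemma chart_smooth_diff c W F x : chart_smooth c W F -> chart_dom c x -> W x ->
  differentiable (F \o chart_inv c) (chart_map c x).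
Proof. by move=> sF cx Wx; apply: (smooth_on_diff sF); exists x. Qed.

Section Instance.
Variables (c : chart M) (W : set M).
Hypothesis oW : open W.
Let oU := @open_chart_img c W oW.
Let dom := chart_dom c `&` W.
Let mem_img x : dom x -> chart_img c W (chart_map c x).
Proof. by move=> ?; exists x. Qed.

Let eq_pd i F G x : (forall z, dom z -> F z = G z) -> dom x -> pd c i F x = pd c i G x.
Proof.
move=> FG dx; apply: (eq_on_partial i oU (mem_img dx)).
exact: eq_on_chart_img.
Qed.

Let smooth_pd i F : chart_smooth c W F -> chart_smooth c W (pd c i F).
Proof.
move=> sF; apply: eq_smooth_on oU _ (smooth_on_partial i sF).
by move=> _ [x [cx Wx] <-] /=; rewrite chart_mapK.
Qed.

Let pd_smoothD i F G x : chart_smooth c W F -> chart_smooth c W G -> dom x ->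
  pd c i (fun z => F z + G z) x = pd c i F x + pd c i G x.
Proof.
move=> sF sG [cx Wx].
exact (partialD i (chart_smooth_diff sF cx Wx) (chart_smooth_diff sG cx Wx)).
Qed.

Let pd_smoothM i F G x : chart_smooth c W F -> chart_smooth c W G -> dom x ->
  pd c i (fun z => F z * G z) x = pd c i F x * G x + F x * pd c i G x.
Proof.
move=> sF sG [cx Wx].
have := partialM i (chart_smooth_diff sF cx Wx) (chart_smooth_diff sG cx Wx).
by rewrite /= chart_mapK.
Qed.

Let pd_comm i j F x : chart_smooth c W F -> dom x ->
  pd c i (pd c j F) x = pd c j (pd c i F) x.
Proof.
move=> sF dx; have := partialC i j oU sF (mem_img dx).
have E k l : partial l (partial k (F \o chart_inv c)) (chart_map c x) = pd c l (pd c k F) x.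
  apply: (eq_on_partial l oU (mem_img dx)) => _ [z [cz Wz] <-] /=.
  by rewrite chart_mapK.
by rewrite !E.
Qed.

Let eq_chart_smooth F G : (forall z, dom z -> F z = G z) ->
  chart_smooth c W F -> chart_smooth c W G.
Proof. by move=> FG; apply: eq_smooth_on oU _; exact: eq_on_chart_img. Qed.

(** Everything is restricted to the part of [W] covered by [c], where [chart_inv c] inverts
    [chart_map c]. *)
Definition chart_calculus : calculus R n dom :=
  @Calculus R n M dom (chart_smooth c W) (pd c)
    (fun a => smooth_on_cst a oU)
    (fun F G => @smooth_onD R n _ (F \o chart_inv c) (G \o chart_inv c) oU)
    (fun F G => @smooth_onM R n _ (F \o chart_inv c) (G \o chart_inv c) oU)
    smooth_pd eq_chart_smooth
    (fun i a x _ => partial_cst i a (chart_map c x))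
    pd_smoothD pd_smoothM eq_pd pd_comm.

Lemma chart_smooth_powR F a : (forall x, dom x -> 0 < F x) ->
  chart_smooth c W F -> chart_smooth c W (fun z => F z `^ a).
Proof.
move=> F0 sF; apply: (smooth_on_powR a oU _ sF) => _ [x [cx Wx] <-] /=.
by rewrite chart_mapK //; apply: F0.
Qed.

Lemma pd_powR i F a x : dom x -> 0 < F x -> chart_smooth c W F ->
  pd c i (fun z => F z `^ a) x = a * F x `^ (a - 1) * pd c i F x.
Proof.
move=> [cx Wx] F0 sF.
have := @partial_powR _ _ i _ a _ _ (chart_smooth_diff sF cx Wx).
by rewrite /= chart_mapK //; exact.
Qed.

Lemma chart_smooth_invmx m (A : M -> 'M[R]_m) :
  (forall x, dom x -> A x \in unitmx) ->
  (forall i j, chart_smooth c W (fun z => A z i j)) ->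
  forall i j, chart_smooth c W (fun z => invmx (A z) i j).
Proof.
move=> uA sA; apply: (@smooth_on_invmx _ _ _ _ (A \o chart_inv c)) => //.
by move=> _ [x [cx Wx] <-] /=; rewrite chart_mapK //; exact: uA.
Qed.

End Instance.

(** * Coordinate functions and the transformation of partial derivatives *)

Definition ccoord d (k : 'I_n) : M -> R := fun y => chart_map d y 0 k.

Lemma ccoord_smooth c d k W : W `<=` chart_dom d -> chart_smooth c W (ccoord d k).
Proof. by move=> Wd; apply: chart_smooth_sub Wd _; exact: chart_transition_smooth. Qed.

(** Near the point, [F \o chart_inv c] factors through the transition map, to which the chain rule
    applies. *)
Lemma pd_change c d F x i : chart_dom c x -> chart_dom d x ->
  differentiable (F \o chart_inv d) (chart_map d x) ->
  pd c i F x = \sum_k pd c i (ccoord d k) x * pd d k F x.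
Proof.
move=> cx dx dF.
pose f z := chart_map d (chart_inv c z).
have fx : f (chart_map c x) = chart_map d x by rewrite /f chart_mapK.
transitivity (partial i (fun z => (F \o chart_inv d) (f z)) (chart_map c x)).
  apply: (@eq_on_partial _ _ _ _ _ (chart_img c (chart_dom d))).
  - by apply: open_chart_img; exact: chart_dom_open.
  - by exists x.
  by move=> _ [z [cz dz] <-] /=; rewrite /f /= !chart_mapK.
rewrite partial_comp /=; last by rewrite fx.
  by rewrite fx.
move=> k; apply: (smooth_on_diff (@chart_transition_smooth _ _ M c d k)).
by exists x.
Qed.

Lemma pd_ccoord d x i j : chart_dom d x -> pd d i (ccoord d j) x = (i == j)%:R.
Proof.
move=> dx.
transitivity (partial i (fun y : 'rV[R]_n => y 0 j) (chart_map d x)).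
  apply: (@eq_on_partial _ _ _ _ _ (chart_img d setT)).
  - by apply: open_chart_img; exact: openT.
  - by exists x.
  by move=> _ [z [dz _] <-] /=; rewrite /ccoord chart_mapK.
have := derive_mx (@derivable_id _ 'rV[R]_n (chart_map d x) (delta_mx 0 i)).
rewrite derive_id => /matrixP/(_ 0 j); rewrite !mxE eqxx /= eq_sym => ->.
by [].
Qed.

End ChartCalculus.

Section Riemann.
Context {R : realType} {n : nat} {M : riemannian R n}.
Implicit Types (c d : chart M) (W : set M) (F G : M -> R).

(** A null vector would violate positivity. *)
Lemma metric_unit c x : chart_dom c x -> metric c x \in unitmx.
Proof.
move=> cx; rewrite unitmxE unitfE; apply/negP => /det0P[v v0 vg].
by have := metric_pos cx v0; rewrite vg mul0mx mxE ltxx.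
Qed.

Lemma chart_smooth_metric c W i j : chart_smooth c W (fun z => metric c z i j).
Proof.
by apply: (smooth_on_sub _ (@metric_smooth _ _ M c i j)) => _ [x [cx _] <-]; exists x.
Qed.

Section Local.
Variables (c : chart M) (W : set M).
Hypothesis oW : open W.

Local Notation g := (metric c).

Lemma chart_smooth_cometric i j : chart_smooth c W (fun z => invmx (g z) i j).
Proof.
by apply: chart_smooth_invmx => // [x [cx _]|k l]; [exact: metric_unit|exact: chart_smooth_metric].
Qed.

Lemma metric_symW z : (chart_dom c `&` W) z -> (g z)^T = g z.
Proof. by case=> cz _; exact: Defs.metric_sym. Qed.

Lemma metric_unitW z : (chart_dom c `&` W) z -> g z \in unitmx.
Proof. by case=> cz _; exact: metric_unit. Qed.

End Local.

(* The inner product <grad F, grad G> and the Laplacian of F, computed in the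
   chart c; [rlip] is convertible to [lip] for the calculus of any chart domain. *)
Definition rlip c F G : M -> R := fun z =>
  \sum_k (\sum_l cometric c z k l * pd c l F z) * pd c k G z.

Definition rlap c F : M -> R := fun z => \tr (cometric c z *m hess F c z).

(** * Transformation laws and invariance under change of charts *)

Definition jac c d x : 'M[R]_n := \matrix_(i, a) pd c i (ccoord d a) x.

Lemma metric_jac c d x : chart_dom c x -> chart_dom d x ->
  metric c x = jac c d x *m metric d x *m (jac c d x)^T.
Proof.
move=> cx dx; apply/matrixP => i j; rewrite (metric_change cx dx) mxE exchange_big.
apply: eq_bigr => b _ /=; rewrite !mxE mulr_suml; apply: eq_bigr => a _.
by rewrite !mxE mulrAC.
Qed.

(** Invertibility of [metric c x] passes to the factors in [metric_jac]. *)
Lemma jac_unit c d x : chart_dom c x -> chart_dom d x -> jac c d x \in unitmx.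
Proof.
move=> cx dx; have := metric_unit cx; rewrite (metric_jac cx dx).
by rewrite !unitmx_mul => /andP[/andP[]].
Qed.

Lemma cometric_jac c d x : chart_dom c x -> chart_dom d x ->
  cometric d x = (jac c d x)^T *m cometric c x *m jac c d x.
Proof.
move=> cx dx; have uJ := jac_unit cx dx.
have E : metric d x *m ((jac c d x)^T *m cometric c x *m jac c d x) = 1%:M.
  (* Multiplying by the Jacobian on the left makes the right-hand side of [metric_jac] appear. *)
  rewrite -[LHS](mulKmx uJ).
  have -> : jac c d x *m (metric d x *m ((jac c d x)^T *m cometric c x *m jac c d x))
    = jac c d x.
    by rewrite !mulmxA -(metric_jac cx dx) mulmxV ?metric_unit // mul1mx.
  by rewrite mulVmx.
by rewrite -[RHS](mulKmx (metric_unit dx)) E mulmx1.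
Qed.

Definition pdv c F x : 'cV[R]_n := \col_k pd c k F x.

Lemma rlip_mx c F G x :
  rlip c F G x = ((pdv c G x)^T *m (cometric c x *m pdv c F x)) 0 0.
Proof.
rewrite mxE; apply: eq_bigr => k _; rewrite !mxE mulrC; congr (_ * _).
by apply: eq_bigr => l _; rewrite mxE.
Qed.

Lemma pdv_jac c d F x : chart_dom c x -> chart_dom d x ->
  differentiable (F \o chart_inv d) (chart_map d x) ->
  pdv c F x = jac c d x *m pdv d F x.
Proof.
move=> cx dx dF; apply/colP => i; rewrite !mxE (pd_change _ cx dx dF).
by apply: eq_bigr => k _; rewrite !mxE.
Qed.

Lemma rlip_invariant c d F G x : chart_dom c x -> chart_dom d x ->
  differentiable (F \o chart_inv d) (chart_map d x) ->
  differentiable (G \o chart_inv d) (chart_map d x) ->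
  rlip c F G x = rlip d F G x.
Proof.
move=> cx dx dF dG; rewrite !rlip_mx (pdv_jac cx dx dF) (pdv_jac cx dx dG).
by rewrite (cometric_jac cx dx) trmx_mul !mulmxA.
Qed.

(* The polarized Hessian identity is applied to a, b among the coordinates of d. *)
Lemma rlap_invariant c d W F x : open W -> chart_dom c x -> chart_dom d x -> W x ->
  chart_smooth c W F -> chart_smooth d W F -> rlap c F x = rlap d F x.
Proof.
move=> oW cx dx Wx sFc0 sFd0.
(* On the overlap both calculi apply, and the coordinates of [d] are smooth in both charts. *)
pose V := W `&` (chart_dom c `&` chart_dom d).
have oV : open V by do 2?apply: openI => //; exact: chart_dom_open.
have VW : V `<=` W by move=> z [].
have Vx : V x by [].
have Vd : V `<=` chart_dom d by move=> z [_ []].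
have sFc := chart_smooth_sub VW sFc0; have sFd := chart_smooth_sub VW sFd0.
pose D := chart_calculus d oV; pose C := chart_calculus c oV.
have sc k : chart_smooth c V (ccoord d k) := ccoord_smooth k Vd.
have sd k : chart_smooth d V (ccoord d k) := ccoord_smooth k Vd.
have df G : chart_smooth d V G -> forall z, V z ->
    differentiable (G \o chart_inv d) (chart_map d z).
  by move=> sG z Vz; apply: (chart_smooth_diff sG) => //; exact: Vd.
have inv G K z : chart_smooth d V G -> chart_smooth d V K -> V z ->
    rlip c G K z = rlip d G K z.
  move=> sG sK Vz; have [_ [cz dz]] := Vz.
  by apply: rlip_invariant => //; exact: df.
have sip G K : chart_smooth d V G -> chart_smooth d V K -> chart_smooth d V (rlip d G K).
  move=> sG sK.
  exact (@smooth_lip _ _ _ _ D _ (@chart_smooth_cometric d V oV) G K sG sK).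
(* The inner function gets differentiated, so [inv] is needed on all of [V] and not only at [x]. *)
have inv2 G K L : chart_smooth d V G -> chart_smooth d V K -> chart_smooth d V L ->
    rlip c L (rlip c G K) x = rlip d L (rlip d G K) x.
  move=> sG sK sL; rewrite -(inv _ _ _ sL (sip _ _ sG sK) Vx).
  apply: eq_bigr => k _.
  have -> // : pd c k (rlip c G K) x = pd c k (rlip d G K) x.
  by apply: (@eq_dd _ _ _ _ C) => // z [_ Vz]; exact: inv.
have pol e (Ve : chart_dom e x) (sF : chart_smooth e V F)
    (se : forall k, chart_smooth e V (ccoord d k)) a b :
  2 * (\sum_i \sum_j lhess (chart_calculus e oV) (metric e) F i j x *
    lgrad (chart_calculus e oV) (metric e) (ccoord d a) i x *
    lgrad (chart_calculus e oV) (metric e) (ccoord d b) j x) =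
  rlip e (ccoord d a) (rlip e F (ccoord d b)) x
  + rlip e (ccoord d b) (rlip e F (ccoord d a)) x
  - rlip e F (rlip e (ccoord d a) (ccoord d b)) x
  := @lhess_polarization _ _ _ _ (chart_calculus e oV) (metric e)
    (@chart_smooth_metric e V) (@chart_smooth_cometric e V oV)
    (@metric_symW e V) (@metric_unitW e V) F (ccoord d a) (ccoord d b) x
    sF (se a) (se b) (conj Ve Vx).
(* In matrix form: the Hessian computed in [e], with both indices raised and then expressed in the
   coordinates of [d]. *)
have polE e a b : \sum_i \sum_j lhess (chart_calculus e oV) (metric e) F i j x *
    lgrad (chart_calculus e oV) (metric e) (ccoord d a) i x *
    lgrad (chart_calculus e oV) (metric e) (ccoord d b) j x =
    ((cometric e x *m jac e d x)^T *m hess F e x *m (cometric e x *m jac e d x)) a b.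
  rewrite mxE exchange_big; apply: eq_bigr => j _; rewrite mxE mulr_suml.
  apply: eq_bigr => i _ /=; rewrite !mxE [X in X * _ = _]mulrC.
  by congr (_ * _ * _); apply: eq_bigr => l _; rewrite !mxE.
have H2 : (cometric c x *m jac c d x)^T *m hess F c x *m (cometric c x *m jac c d x)
   = (cometric d x *m jac d d x)^T *m hess F d x *m (cometric d x *m jac d d x).
  apply/matrixP => a b; rewrite -!polE.
  have two0 : 2 != 0 :> R by rewrite pnatr_eq0.
  apply: (mulfI two0).
  rewrite (pol c cx sFc sc a b) (pol d dx sFd sd a b).
  rewrite (inv2 _ _ _ sFd (sd b) (sd a)) (inv2 _ _ _ sFd (sd a) (sd b)).
  by rewrite (inv2 _ _ _ (sd a) (sd b) sFd).
have J1 : jac d d x = 1%:M.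
  by apply/matrixP => i j; rewrite !mxE pd_ccoord.
have gT e : chart_dom e x -> (cometric e x)^T = cometric e x.
  by move=> ex; rewrite /cometric trmx_inv Defs.metric_sym.
rewrite J1 mulmx1 trmx_mul (gT c cx) (gT d dx) in H2.
(* The Laplacian is recovered from the raised Hessian by contraction with the metric. *)
have -> : rlap d F x = \tr (metric d x *m (cometric d x *m hess F d x *m cometric d x)).
  rewrite [RHS]mxtrace_mulC -(mulmxA _ (cometric d x) (metric d x)).
  have -> : cometric d x *m metric d x = 1%:M by exact: mulVmx (metric_unit dx).
  by rewrite mulmx1.
rewrite -H2.
have -> : metric d x *m ((jac c d x)^T *m cometric c x *m hess F c x *m
      (cometric c x *m jac c d x)) =
    metric d x *m (jac c d x)^T *m cometric c x *m hess F c x *m cometric c x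
      *m jac c d x by rewrite !mulmxA.
(* Cyclicity of the trace brings the two Jacobian factors around [metric d x], giving [metric c x],
   which cancels one [cometric c x]. *)
rewrite [RHS]mxtrace_mulC !mulmxA -(metric_jac cx dx) mulmxV ?metric_unit //.
by rewrite mul1mx [RHS]mxtrace_mulC.
Qed.

End Riemann.

(** * The perturbed p-Laplace equation *)

Section Main.
Context {R : realType} {n : nat} {M : riemannian R n}.
Implicit Types (c d : chart M) (W : set M) (F G : M -> R).

Lemma inner_grad F G y : inner (grad F) (grad G) y = rlip (chart_at y) F G y.
Proof.
have cy : (chart_dom (chart_at y) `&` setT) y by split => //; exact: chart_at_dom.
apply: eq_bigr => i _; rewrite mxE.
rewrite -[pd _ i G y](@metricK _ _ _ _ _ (@metric_unitW _ _ _ (chart_at y) setT)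
  y (fun k => pd (chart_at y) k G y) i cy).
rewrite mulr_sumr; apply: eq_bigr => j _; rewrite mxE.
by rewrite mulrCA mulrA.
Qed.

Lemma eq_rlipr c W F G G' y : open W -> (chart_dom c `&` W) y ->
  (forall z, (chart_dom c `&` W) z -> G z = G' z) -> rlip c F G y = rlip c F G' y.
Proof.
move=> oW Wy GG; apply: eq_bigr => k _.
by have -> : pd c k G y = pd c k G' y by exact: (@eq_dd _ _ _ _ (chart_calculus c oW)).
Qed.

Lemma normsq_ge0 (X : vfield M) y : 0 <= normsq X y.
Proof.
have E : normsq X y =
    (X (chart_at y) y *m metric (chart_at y) y *m (X (chart_at y) y)^T) 0 0.
  rewrite /normsq /inner /eval2 exchange_big mxE; apply: eq_bigr => j _ /=.
  rewrite !mxE mulr_suml; apply: eq_bigr => i _.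
  by rewrite [X in X * _]mulrC.
rewrite E; have [->|X0] := eqVneq (X (chart_at y) y) 0.
  by rewrite !mul0mx mxE.
exact: ltW (metric_pos (chart_at_dom y) X0).
Qed.

Section Solution.
Variables (eps p : R) (u : M -> R) (Omega : set M).
Hypothesis eps0 : 0 < eps.
Hypothesis oO : open Omega.
Hypothesis sol : perturbed_pharmonic_on eps p u Omega.

Let su c : chart_smooth c Omega u := sol.1 c.

Local Notation C c := (chart_calculus c oO).

(** The square of [feps] in one fixed chart, whereas [normsq] changes chart from point to point. *)
Let fsq c : M -> R := fun z => rlip c u u z + eps.

(** * The solution and its weight in a fixed chart *)

Lemma chart_smooth_rlip c F G : chart_smooth c Omega F -> chart_smooth c Omega G ->
  chart_smooth c Omega (rlip c F G).
Proof.
move=> sF sG.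
exact (@smooth_lip _ _ _ _ (C c) _ (@chart_smooth_cometric _ _ _ c Omega oO) F G sF sG).
Qed.

Lemma inner_grad_chart c F G y : chart_dom c y -> Omega y ->
  chart_smooth c Omega F -> chart_smooth c Omega G ->
  inner (grad F) (grad G) y = rlip c F G y.
Proof.
move=> cy Oy sF sG; rewrite inner_grad.
apply: (rlip_invariant (chart_at_dom y) cy).
  exact: chart_smooth_diff sF cy Oy.
exact: chart_smooth_diff sG cy Oy.
Qed.

Lemma normsq_chart c y : (chart_dom c `&` Omega) y ->
  normsq (grad u) y + eps = fsq c y.
Proof. by case=> cy Oy; rewrite /normsq (@inner_grad_chart c). Qed.

Lemma fsq_gt0 c y : (chart_dom c `&` Omega) y -> 0 < fsq c y.
Proof. by move=> Wy; rewrite -normsq_chart // ltr_wpDl // normsq_ge0. Qed.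

Lemma chart_smooth_fsq c : chart_smooth c Omega (fsq c).
Proof.
exact (@smoothD _ _ _ _ (C c) _ _ (chart_smooth_rlip (@su c) (@su c)) (smooth_cst (C c) eps)).
Qed.

Let a : R := (p - 2) / 2.
Let weight c : M -> R := fun z => fsq c z `^ a.

Lemma chart_smooth_weight c : chart_smooth c Omega (weight c).
Proof. by apply: (chart_smooth_powR oO) (@chart_smooth_fsq c) => y; exact: fsq_gt0. Qed.

Lemma pd_fsq c i y : (chart_dom c `&` Omega) y -> pd c i (fsq c) y = pd c i (rlip c u u) y.
Proof.
move=> Wy.
apply: etrans (@ddD _ _ _ _ (C c) i (rlip c u u) (fun=> eps) y
  (chart_smooth_rlip (@su c) (@su c)) (smooth_cst (C c) eps) Wy) _.
by rewrite dd_cst // addr0.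
Qed.

Lemma pd_weight c i y : (chart_dom c `&` Omega) y ->
  pd c i (weight c) y = a * (weight c y / fsq c y) * pd c i (rlip c u u) y.
Proof.
move=> Wy; rewrite (pd_powR i a Wy (fsq_gt0 Wy) (@chart_smooth_fsq c)) pd_fsq //.
congr (_ * _ * _); rewrite /weight powRD; last by apply/implyP => _; rewrite gt_eqF // fsq_gt0.
by rewrite powR_inv1 // ltW // fsq_gt0.
Qed.

Local Notation X c := (lgrad (C c) (metric c) u).

(** The weight may be written in the chart [chart_at y], since [normsq_chart] holds on all of its
    domain in [Omega] and not just at [y]. *)
Lemma equation_at y : Omega y ->
  ldiv (C (chart_at y)) (metric (chart_at y))
    (fun k z => weight (chart_at y) z * X (chart_at y) k z) y = 0.
Proof.
move=> Oy; set c := chart_at y.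
have Wy : (chart_dom c `&` Omega) y by split => //; exact: chart_at_dom.
rewrite -[RHS](sol.2 y Oy).
apply: (@eq_ldiv _ _ _ _ (C c)) => // k z Wz.
by rewrite !mxE (normsq_chart Wz).
Qed.

Lemma llap_rlap c y : (chart_dom c `&` Omega) y ->
  llap (C c) (metric c) u y = rlap c u y.
Proof.
move=> Wy; rewrite /rlap; apply: eq_bigr => i _; rewrite mxE.
apply: eq_bigr => j _.
rewrite (@lhessC _ _ _ _ (C c) _ (@metric_symW _ _ _ c Omega) u i j y (@su c) Wy).
by rewrite !mxE.
Qed.

(* The equation in nondivergence form. It holds a priori at y in the chart
   [chart_at y] only, and is transported to c by invariance. *)
Lemma equation_chart c y : (chart_dom c `&` Omega) y ->
  (p - 2) / fsq c y * rlip c u (rlip c u u) y = - 2 * llap (C c) (metric c) u y.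
Proof.
move=> Wy; have [cy Oy] := Wy; set d := chart_at y.
have dy : chart_dom d y by exact: chart_at_dom.
have Wdy : (chart_dom d `&` Omega) y by [].
have siu : rlip d u u y = rlip c u u y.
  by apply: (rlip_invariant dy cy); exact: chart_smooth_diff (@su c) cy Oy.
have sd : fsq d y = fsq c y by rewrite /fsq siu.
(* The inner [rlip] is differentiated, so its change of chart is made on the whole overlap. *)
have siuu : rlip d u (rlip d u u) y = rlip c u (rlip c u u) y.
  rewrite -(rlip_invariant dy cy (chart_smooth_diff (@su c) cy Oy)); last first.
    exact: chart_smooth_diff (chart_smooth_rlip (@su c) (@su c)) cy Oy.
  apply: (eq_rlipr _ (openI oO (@chart_dom_open _ _ M c))); first by [].
  move=> z [dz [Oz cz]].
  by apply: (rlip_invariant dz cz); exact: chart_smooth_diff (@su c) cz Oz.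
have s0 : fsq c y != 0 := lt0r_neq0 (fsq_gt0 Wy).
have q0 : weight c y != 0 := lt0r_neq0 (powR_gt0 _ (fsq_gt0 Wy)).
have sX m : chart_smooth d Omega (X d m).
  exact (@smooth_lgrad _ _ _ _ (C d) _ (@chart_smooth_cometric _ _ _ d Omega oO) _ m (@su d)).
have := equation_at Oy; rewrite -/d.
rewrite (@ldivM _ _ _ _ (C d) _ _ _ _ (@chart_smooth_weight d) sX Wdy).
rewrite (@ldiv_lgrad _ _ _ _ (C d) _ (@chart_smooth_metric _ _ _ d Omega)
  (@chart_smooth_cometric _ _ _ d Omega oO) (@metric_symW _ _ _ d Omega)
  (@metric_unitW _ _ _ d Omega) _ _ (@su d) Wdy).
have -> : \sum_i X d i y * dd (C d) i (weight d) y =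
    a * (weight d y / fsq d y) * rlip d u (rlip d u u) y.
  rewrite [in RHS]/rlip mulr_sumr; apply: eq_bigr => i _.
  have -> : dd (C d) i (weight d) y = a * (weight d y / fsq d y) * pd d i (rlip d u u) y by exact: pd_weight.
  by rewrite mulrCA.
rewrite (llap_rlap Wdy) (llap_rlap Wy) (rlap_invariant oO dy cy Oy (@su d) (@su c)) siuu.
rewrite /weight sd -/(weight c y) /a => E.
(* The divergence has been expanded as weight times Laplacian plus the derivative of the weight
   along the gradient; the positive weight is now cancelled. *)
apply: (mulfI q0); move: E.
set Q := weight c y; set L := rlap c u y; set I := rlip c u _ y => E.
have -> : Q * (-2 * L) = -2 * (Q * L) by ring.
have -> : Q * L = - ((p - 2) / 2 * (Q / fsq c y) * I) by apply/eqP; rewrite -addr_eq0 E.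
by field.
Qed.

(** * The linearized operator applied to the square of [feps] *)

Lemma feps_powR y b : feps eps u y `^ b = (normsq (grad u) y + eps) `^ (b / 2).
Proof.
rewrite /feps -powR12_sqrt; last by rewrite addr_ge0 ?normsq_ge0 // ltW.
by rewrite -powRrM mulrC.
Qed.

Lemma feps_sqr y : feps eps u y ^+ 2 = normsq (grad u) y + eps.
Proof. by rewrite sqr_sqrtr // addr_ge0 ?normsq_ge0 // ltW. Qed.

Local Notation Psi := (fun y => feps eps u y ^+ 2).

Lemma chart_smooth_Psi c : chart_smooth c Omega Psi.
Proof.
apply: (@eq_smooth _ _ _ _ (C c) (fsq c)); last exact: chart_smooth_fsq.
by move=> z Wz; rewrite feps_sqr (normsq_chart Wz).
Qed.

Lemma pd_Psi c i y : (chart_dom c `&` Omega) y ->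
  pd c i Psi y = pd c i (rlip c u u) y.
Proof.
move=> Wy; rewrite -pd_fsq //; apply: (@eq_dd _ _ _ _ (C c)) => // z Wz.
by rewrite feps_sqr (normsq_chart Wz).
Qed.

Lemma bochner_pharmonic x : Omega x ->
  2^-1 * Leps eps p u Psi x
  = (p - 2) / 4 * feps eps u x `^ (p - 4) * normsq (grad Psi) x
    + feps eps u x `^ (p - 2)
      * (tensor2_normsq (hess u) x + eval2 (@ricci R n M) (grad u) (grad u) x).
Proof.
move=> Ox; set c := chart_at x.
have cx : chart_dom c x by exact: chart_at_dom.
have Wx : (chart_dom c `&` Omega) x by [].
have gPsi k y : (chart_dom c `&` Omega) y ->
    grad Psi c y 0 k = lgrad (C c) (metric c) (rlip c u u) k y.
  by move=> Wy; rewrite mxE; apply: eq_bigr => l _; rewrite (pd_Psi _ Wy).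
(* [equation_chart] turns the rank-one term of [Aeps] into a multiple of the Laplacian; it holds
   throughout the chart in [Omega], as the outer divergence requires. *)
have LE : Leps eps p u Psi x = ldiv (C c) (metric c) (fun k y => weight c y *
    (lgrad (C c) (metric c) (rlip c u u) k y
     - 2 * llap (C c) (metric c) u y * X c k y)) x.
  apply: (@eq_ldiv _ _ _ _ (C c)) => // k y Wy.
  transitivity (feps eps u y `^ (p - 2) * (grad Psi c y 0 k
      + (p - 2) / feps eps u y ^+ 2 * inner (grad u) (grad Psi) y * grad u c y 0 k)).
    by rewrite !mxE.
  have -> : grad u c y 0 k = X c k y by rewrite mxE.
  rewrite (gPsi _ _ Wy) feps_powR (normsq_chart Wy) -/a; congr (_ * (_ + _)).
  rewrite feps_sqr (normsq_chart Wy) (inner_grad_chart Wy.1 Wy.2 (@su c) (@chart_smooth_Psi c)).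
  have -> : rlip c u Psi y = rlip c u (rlip c u u) y.
    by apply: eq_bigr => l _; rewrite (pd_Psi _ Wy).
  by rewrite (equation_chart Wy) mulNr mulNr.
rewrite LE.
have B := @bochner_weighted _ _ _ _ (C c) _ (@chart_smooth_metric _ _ _ c Omega)
  (@chart_smooth_cometric _ _ _ c Omega oO) (@metric_symW _ _ _ c Omega)
  (@metric_unitW _ _ _ c Omega) u (weight c) x (@su c) (@chart_smooth_weight c) Wx (equation_at Ox).
rewrite -[ldiv _ _ _ _]/(ldiv (C c) (metric c) (fun k y => weight c y *
  (lgrad (C c) (metric c) (lip (C c) (metric c) u u) k y
     - 2 * llap (C c) (metric c) u y * X c k y)) x) B.
congr (_ + _).
  (* By [pd_weight] the gradient of the weight is a multiple of grad Psi. The factors 1/2 and [a]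
     make up [(p - 2) / 4], and dividing by [fsq] lowers the power of [feps] from [p - 2] to
     [p - 4]. *)
  have -> : \sum_i lgrad (C c) (metric c) (lip (C c) (metric c) u u) i x * dd (C c) i (weight c) x
     = a * (weight c x / fsq c x) * normsq (grad Psi) x.
    rewrite /normsq (inner_grad_chart cx Ox (@chart_smooth_Psi c) (@chart_smooth_Psi c)).
    rewrite mulr_sumr; apply: eq_bigr => i _.
    have -> : dd (C c) i (weight c) x = a * (weight c x / fsq c x) * pd c i (rlip c u u) x by exact: pd_weight.
    have -> : \sum_l cometric c x i l * pd c l Psi x =
        lgrad (C c) (metric c) (lip (C c) (metric c) u u) i x.
      by apply: eq_bigr => l _; rewrite (pd_Psi _ Wx).
    by rewrite (pd_Psi _ Wx) mulrCA.
  have -> : feps eps u x `^ (p - 4) = weight c x / fsq c x.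
    rewrite feps_powR (normsq_chart Wx).
    have -> : (p - 4) / 2 = a + -1 by rewrite /a; field.
    rewrite powRD; last by apply/implyP => _; rewrite gt_eqF // fsq_gt0.
    by rewrite powR_inv1 // ltW // fsq_gt0.
  by rewrite /a; field; rewrite gt_eqF // fsq_gt0.
congr (_ * (_ + _)).
- by rewrite feps_powR (normsq_chart Wx).
- rewrite -(@hess_normsqE _ _ _ _ (C c) _ (@chart_smooth_metric _ _ _ c Omega)
    (@chart_smooth_cometric _ _ _ c Omega oO) (@metric_symW _ _ _ c Omega)
    (@metric_unitW _ _ _ c Omega) _ _ (@su c) Wx).
  by do 4 apply: eq_bigr => ? _; rewrite !mxE.
- by apply: eq_bigr => j _; apply: eq_bigr => m _; rewrite !mxE.
Qed.

End Solution.
End Main.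

Theorem lemma3p2 (R : realType) (n : nat) (M : riemannian R n) (Omega : set M)
    (eps p : R) (u : M -> R) :
  domain Omega -> 0 < eps -> 1 < p ->
  perturbed_pharmonic_on eps p u Omega ->
  forall x : M, Omega x ->
    2^-1 * Leps eps p u (fun y => feps eps u y ^+ 2) x
    = (p - 2) / 4 * feps eps u x `^ (p - 4)
        * normsq (grad (fun y => feps eps u y ^+ 2)) x
      + feps eps u x `^ (p - 2)
        * (tensor2_normsq (hess u) x + eval2 (@ricci R n M) (grad u) (grad u) x).
Proof.
move=> [oO _ _] eps0 _ sol x; exact: bochner_pharmonic.
Qed.
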